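(* Let $(g,\xi^0,\ldots,\xi^{k-1},\mu^0,\ldots,\mu^{k-1})$ be a solution of the Euler--Lagrange system (interior equations (I1)--(I5) and node equations (N1)--(N4), listed in the context) of the inexact trajectory planning problem with node times $0=t_0<t_1<\cdots<t_l$, and let $q(t)=g(t)Q_0$. Then for every $t$ in any of the open intervals $(t_s,t_{s+1})$, $s=0,\ldots,l-1$, as well as for $t\in\{0,t_l\}$, $$\langle\mu^0(t),\rho\rangle=0\qquad\text{for all }\rho\in\mathfrak g_{q(t)},$$ where, for $q\in Q$, $\mathfrak g_q$ denotes the Lie algebra of the isotropy subgroup $G_q=\{h\in G : hq=q\}$.
   Context: Setting. $G$ is a finite-dimensional Lie group with Lie algebra $\mathfrak g$ and identity $e$, acting smoothly from the left on a finite-dimensional manifold $Q$. $d:Q\times Q\to\mathbb R$ is a distance function. $Q_0,Q_{t_1},\ldots,Q_{t_l}\in Q$ are given points, $0=t_0<t_1<\cdots<t_l$ are given times, $\sigma>0$, $k\ge 1$ is an integer, and $\ell:\mathfrak g^k\to\mathbb R$ is a smooth function; $\frac{\delta\ell}{\delta\xi^r}\in\mathfrak g^*$ denotes its partial derivative in the $r$-th argument ($r=0,\dots,k-1$). $\langle\cdot,\cdot\rangle$ denotes duality pairings. $R_g$ and $L_g$ are right and left multiplication by $g$, with differentials $TR_g$, $TL_g$. Notation. $\operatorname{Ad}_g\xi=TL_gTR_{g^{-1}}\xi$; $\operatorname{ad}_\xi\eta=\frac{d}{d\varepsilon}\big|_{\varepsilon=0}\operatorname{Ad}_{\exp(\varepsilon\xi)}\eta$;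 $\operatorname{ad}^*_\xi$ is the linear dual: $\langle\operatorname{ad}^*_\xi\mu,\eta\rangle=\langle\mu,\operatorname{ad}_\xi\eta\rangle$. For $\xi\in\mathfrak g$, $q\in Q$: $\xi_Q(q)=\frac{d}{d\varepsilon}\big|_{\varepsilon=0}\exp(\varepsilon\xi)q\in T_qQ$. The cotangent lift momentum map $J^Q:T^*Q\to\mathfrak g^*$ is defined by $\langle J^Q(\alpha_q),\xi\rangle=\langle\alpha_q,\xi_Q(q)\rangle$ for all $\alpha_q\in T_q^*Q$, $\xi\in\mathfrak g$. $\mathrm{d}_1d(q_1,q_2)\in T^*_{q_1}Q$ is the differential of $d$ with respect to its first argument. $d(t_i):=d(g(t_i)Q_0,Q_{t_i})$ and $\mathrm{d}_1d(t_i):=\mathrm{d}_1d(g(t_i)Q_0,Q_{t_i})$. It is assumed that $d$ is differentiable in its first argument at the points $(g(t_i)Q_0,Q_{t_i})$ (if $d(t_i)=0$, the product $d(t_i)\,\mathrm{d}_1d(t_i)$ is read as the differential of $\tfrac12d^2$ in the first argument). $\mu^r(t_s^-)=\lim_{t\uparrow t_s}\mu^r(t)$, $\mu^r(t_s^+)=\lim_{t\downarrow t_s}\mu^r(t)$; values at $t=0$ and $t=t_l$ are the corresponding one-sided limits. A solution consists of curves $g$ in $G$, $\xi^0,\ldots,\xi^{k-1}$ in $\mathfrak g$, $\mu^0,\ldots,\mu^{k-1}$ in $\mathfrak g^*$ on $[0,t_l]$, which are $C^1$ on each open interval $(t_{i-1},t_i)$, with the one-sided limits of the $\mu^r$ at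 the $t_i$ existing, with $g,\xi^0,\ldots,\xi^{k-2}$ continuous on $[0,t_l]$, $g(0)=e$ and $\xi^j(0)=\xi^j_0$ prescribed for $j=0,\ldots,k-2$, satisfying on every open interval $(t_i,t_{i+1})$, $i=0,\ldots,l-1$: (I1) $\dot\mu^0+\operatorname{ad}^*_{\xi^0}\mu^0=0$; (I2) $TR_{g^{-1}}\dot g=\xi^0$; (I3) $\dot\xi^{r-1}=\xi^r$, $r=1,\ldots,k-1$; (I4) $\dot\mu^r+\mu^{r-1}-\frac{\delta\ell}{\delta\xi^{r-1}}=0$, $r=1,\ldots,k-1$; (I5) $\mu^{k-1}=\frac{\delta\ell}{\delta\xi^{k-1}}$; and at the nodes: (N1) $\mu^0(t_s^-)-\mu^0(t_s^+)+\frac{d(t_s)}{\sigma^2}J^Q(\mathrm{d}_1d(t_s))=0$, $s=1,\ldots,l-1$; (N2) $\mu^r(t_s^-)-\mu^r(t_s^+)=0$, $r=1,\ldots,k-1$, $s=1,\ldots,l-1$; (N3) $\mu^0(t_l)+\frac{d(t_l)}{\sigma^2}J^Q(\mathrm{d}_1d(t_l))=0$; (N4) $\mu^r(t_l)=0$, $r=1,\ldots,k-1$. *)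

(* Defs.v *)
From HB Require Import structures.
From mathcomp Require Import all_boot all_order all_algebra.
From mathcomp Require Import all_classical all_reals all_analysis.
Set Implicit Arguments.
Unset Strict Implicit.
Unset Printing Implicit Defensive.
Import Order.TTheory GRing.Theory Num.Theory.
Import numFieldNormedType.Exports.
Local Open Scope classical_set_scope.
Local Open Scope ring_scope.

(* C^j on an open subset U of a finite-dimensional normed space. *)
Fixpoint Ck {R : realType} {V W : normedModType R} (j : nat) (U : set V)
    (f : V -> W) : Prop :=
  match j with
  | 0%N => forall x, U x -> {for x, continuous f}
  | i.+1 => (forall x, U x -> differentiable f x) /\
            (forall v : V, Ck i U (fun x => 'D_v f x))
  end.

Definition smooth_on {R : realType} {V W : normedModType R} (U : set V)
  (f : V -> W) : Prop := forall j, Ck j U f.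

(* The dual of 'rV_n is 'cV_n. *)
Definition pairing {R : realType} {n : nat} (mu : 'cV[R]_n) (x : 'rV[R]_n) : R :=
  (x *m mu) 0 0.

Definition covec {R : realType} {n : nat} (f : 'rV[R]_n -> R) : 'cV[R]_n :=
  \col_i f (delta_mx 0 i).

Lemma pairing_covec (R : realType) (n : nat) (f : {linear 'rV[R]_n -> R^o})
  (x : 'rV[R]_n) : pairing (covec f) x = f x.
Proof.
rewrite /pairing mxE [in RHS](row_sum_delta x) linear_sum /=.
by apply: eq_bigr => i _; rewrite mxE linearZ.
Qed.

(* [cinv] is a total function; only its values on the image of the domain are
   meaningful. *)
Record chart (R : realType) (n : nat) (M : topologicalType) := Chart {
  cdom : set M;
  coord :> M -> 'rV[R]_n;
  cinv : 'rV[R]_n -> M;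
  cdom_open : open cdom;
  cimg_open : open (coord @` cdom);
  coordK : forall p, cdom p -> cinv (coord p) = p;
  coord_continuous : forall p, cdom p -> {for p, continuous coord};
  cinv_continuous : forall p, cdom p -> {for coord p, continuous cinv} }.

(* Smooth manifolds of dimension n without boundary.  [chart_at p] is a chosen
   chart around p, which identifies T_pM with 'rV_n and T*_pM with 'cV_n: a
   tangent vector at p is given by its components in [chart_at p]. *)
Record manifold (R : realType) (n : nat) := Manifold {
  mfd_space :> topologicalType;
  atlas : set (chart R n mfd_space);
  chart_at : mfd_space -> chart R n mfd_space;
  chart_at_atlas : forall p, atlas (chart_at p);
  chart_at_dom : forall p, cdom (chart_at p) p;
  transition_smooth : forall a b, atlas a -> atlas b ->
    smooth_on (a @` (cdom a `&` cdom b)) (b \o cinv a);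
  mfd_hausdorff : hausdorff_space mfd_space;
  mfd_second_countable : @second_countable mfd_space }.

Section Smooth_maps.
Variables (R : realType) (m n p : nat).
Variables (M : manifold R m) (N : manifold R n) (P : manifold R p).

Definition smooth_map (f : M -> N) : Prop :=
  continuous f /\
  forall a b, atlas a -> atlas b ->
    smooth_on (a @` (cdom a `&` f @^-1` cdom b)) (b \o f \o cinv a).

(* Smoothness on the product manifold M x N, whose atlas consists of the
   products of charts of M and N. *)
Definition smooth_map2 (f : M -> N -> P) : Prop :=
  continuous (fun x : M * N => f x.1 x.2) /\
  forall a b c, atlas a -> atlas b -> atlas c ->
    smooth_on
      [set (a x.1, b x.2) | x in
         [set x : M * N | [/\ cdom a x.1, cdom b x.2 & cdom c (f x.1 x.2)]]]
      (fun v : 'rV[R]_m * 'rV[R]_n => c (f (cinv a v.1) (cinv b v.2))).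

Definition tangent_map (f : M -> N) (x : M) : 'rV[R]_m -> 'rV[R]_n :=
  'd (chart_at (f x) \o f \o cinv (chart_at x)) (chart_at x x).

Definition velocity (c : R -> M) (t : R) : 'rV[R]_m :=
  derive1 (fun s => chart_at (c t) (c s)) t.

Definition curve_Ck (j : nat) (I : set R) (c : R -> M) : Prop :=
  (forall t, I t -> {for t, continuous c}) /\
  forall a, atlas a -> Ck j (I `&` c @^-1` cdom a) (a \o c).

Definition fun_differentiable (f : M -> R) (x : M) : Prop :=
  differentiable (f \o cinv (chart_at x)) (chart_at x x).

Definition fun_differential (f : M -> R) (x : M) : 'cV[R]_m :=
  covec ('d (f \o cinv (chart_at x)) (chart_at x x)).

Definition is_distance (d : M -> M -> R) : Prop :=
  [/\ forall x y, 0 <= d x y,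
      forall x y, d x y = 0 <-> x = y,
      forall x y, d x y = d y x &
      forall x y z, d x z <= d x y + d y z].

End Smooth_maps.

Record lieGroup (R : realType) (n : nat) := LieGroup {
  lie_mfd :> manifold R n;
  lie_one : lie_mfd;
  lie_mul : lie_mfd -> lie_mfd -> lie_mfd;
  lie_inv : lie_mfd -> lie_mfd;
  lie_mulA : associative lie_mul;
  lie_mul1 : left_id lie_one lie_mul;
  lie_mulV : left_inverse lie_one lie_inv lie_mul;
  lie_mul_smooth : smooth_map2 lie_mul;
  lie_inv_smooth : smooth_map lie_inv }.

Section Lie_groups.
Variables (R : realType) (n m : nat) (G : lieGroup R n) (Q : manifold R m).

(* The Lie algebra of G is T_eG, hence 'rV_n.
   [e] is the exponential map: t |-> e (t x) is the one-parameter subgroup with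
   initial velocity x, for every x.  This determines [e] uniquely. *)
Definition is_exp (e : 'rV[R]_n -> G) : Prop :=
  forall x : 'rV[R]_n,
  [/\ forall j, curve_Ck j setT (fun t : R => e (t *: x)),
      forall s t : R, e ((s + t) *: x) = lie_mul (e (s *: x)) (e (t *: x)) &
      velocity (fun t : R => e (t *: x)) 0 = x].

Definition Ad (g : G) (x : 'rV[R]_n) : 'rV[R]_n :=
  tangent_map (lie_mul g) (lie_inv g)
    (tangent_map (fun h => lie_mul h (lie_inv g)) (lie_one G) x).

Record smooth_action (act : G -> Q -> Q) : Prop := {
  act1 : forall q, act (lie_one G) q = q;
  actM : forall g h q, act (lie_mul g h) q = act g (act h q);
  act_smooth : smooth_map2 act }.

Variables (e : 'rV[R]_n -> G) (act : G -> Q -> Q).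

Definition ad (x y : 'rV[R]_n) : 'rV[R]_n :=
  derive1 (fun eps : R => Ad (e (eps *: x)) y) 0.

Definition ad_star (x : 'rV[R]_n) (mu : 'cV[R]_n) : 'cV[R]_n :=
  covec (fun y => pairing mu (ad x y)).

Definition inf_gen (x : 'rV[R]_n) (q : Q) : 'rV[R]_m :=
  velocity (fun eps : R => act (e (eps *: x)) q) 0.

Definition momentum (q : Q) (alpha : 'cV[R]_m) : 'cV[R]_n :=
  covec (fun x => pairing alpha (inf_gen x q)).

Definition isotropy (q : Q) : set G := [set h | act h q = q].

(* The Lie algebra of a closed subgroup H of G (isotropy groups are closed), as a
   subspace of T_eG. *)
Definition lie_subalg (H : set G) : set 'rV[R]_n :=
  [set x | forall t : R, H (e (t *: x))].

End Lie_groups.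

Section Trajectory_planning.
Variables (R : realType) (n m : nat) (G : lieGroup R n) (Q : manifold R m).
Variables (e : 'rV[R]_n -> G) (act : G -> Q -> Q) (d : Q -> Q -> R).

Definition half_sq_dist (q1 q2 : Q) : R := (d q1 q2) ^+ 2 / 2.

(* d(.,q2) has to be differentiable at q1 when d q1 q2 <> 0; at a zero of d only
   d(.,q2)^2 / 2 is. *)
Definition dist_regular (q1 q2 : Q) : Prop :=
  if d q1 q2 == 0 then fun_differentiable (half_sq_dist^~ q2) q1
  else fun_differentiable (d^~ q2) q1.

(* d(q1,q2) d_1d(q1,q2), read as the differential of d(.,q2)^2 / 2 at a zero
   of d. *)
Definition dist_ddist (q1 q2 : Q) : 'cV[R]_m :=
  if d q1 q2 == 0 then fun_differential (half_sq_dist^~ q2) q1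
  else d q1 q2 *: fun_differential (d^~ q2) q1.

(* g^k is the space of k x n matrices; row r is the r-th argument of ell. *)
Definition partial_diff (k : nat) (ell : 'M[R]_(k, n) -> R) (r : 'I_k)
    (X : 'M[R]_(k, n)) : 'cV[R]_n :=
  covec (fun y : 'rV[R]_n => 'd ell X ((delta_mx r 0 : 'cV[R]_k) *m y)).

Variables (Q0 : Q) (k : nat) (hk : (0 < k)%N) (ell : 'M[R]_(k, n) -> R).
Variables (sigma : R) (l : nat).
(* The node times t_0, ..., t_l and the targets at t_1, ..., t_l; further values
   of these sequences are not used. *)
Variables (tn : nat -> R) (Qn : nat -> Q).
Variables (g : R -> G) (xi : 'I_k -> R -> 'rV[R]_n) (mu : 'I_k -> R -> 'cV[R]_n).

Definition jet (t : R) : 'M[R]_(k, n) := \matrix_(r < k) xi r t.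

Definition mu_left (r : 'I_k) (t : R) : 'cV[R]_n := lim (mu r s @[s --> t^'-]).
Definition mu_right (r : 'I_k) (t : R) : 'cV[R]_n := lim (mu r s @[s --> t^'+]).

Definition node_force (s : nat) : 'cV[R]_n :=
  (sigma ^+ 2)^-1 *:
    momentum e act (act (g (tn s)) Q0)
      (dist_ddist (act (g (tn s)) Q0) (Qn s)).

Let r0 : 'I_k := Ordinal hk.

Record curves_regular (xi0 : 'I_k -> 'rV[R]_n) : Prop := {
  reg_g : forall i, (i < l)%N -> curve_Ck 1 `]tn i, tn i.+1[ g;
  reg_xi : forall i r, (i < l)%N -> Ck 1 `]tn i, tn i.+1[ (xi r);
  reg_mu : forall i r, (i < l)%N -> Ck 1 `]tn i, tn i.+1[ (mu r);
  reg_mu_left : forall i r, (i < l)%N -> cvg (mu r s @[s --> (tn i.+1)^'-]);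
  reg_mu_right : forall i r, (i < l)%N -> cvg (mu r s @[s --> (tn i)^'+]);
  cont_g : {within `[0, tn l], continuous g};
  cont_xi : forall r : 'I_k, (r.+1 < k)%N ->
    {within `[0, tn l], continuous (xi r)};
  init_g : g 0 = lie_one G;
  init_xi : forall r : 'I_k, (r.+1 < k)%N -> xi r 0 = xi0 r }.

Record interior_eqs (t : R) : Prop := {
  eqI1 : derive1 (mu r0) t + ad_star e (xi r0 t) (mu r0 t) = 0;
  eqI2 : tangent_map (fun h => lie_mul h (lie_inv (g t))) (g t) (velocity g t)
         = xi r0 t;
  eqI3 : forall p r : 'I_k, r = p.+1 :> nat -> derive1 (xi p) t = xi r t;
  eqI4 : forall p r : 'I_k, r = p.+1 :> nat ->
    derive1 (mu r) t + mu p t - partial_diff ell p (jet t) = 0;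
  eqI5 : forall r : 'I_k, r.+1 = k -> mu r t = partial_diff ell r (jet t) }.

Record node_eqs : Prop := {
  eqN1 : forall s, (0 < s < l)%N ->
    mu_left r0 (tn s) - mu_right r0 (tn s) + node_force s = 0;
  eqN2 : forall (r : 'I_k) s, (0 < r)%N -> (0 < s < l)%N ->
    mu_left r (tn s) - mu_right r (tn s) = 0;
  eqN3 : mu_left r0 (tn l) + node_force l = 0;
  eqN4 : forall r : 'I_k, (0 < r)%N -> mu_left r (tn l) = 0 }.

Definition EL_solution (xi0 : 'I_k -> 'rV[R]_n) : Prop :=
  [/\ curves_regular xi0,
      forall i t, (i < l)%N -> tn i < t < tn i.+1 -> interior_eqs t &
      node_eqs].

End Trajectory_planning.

(* Main.v *)
(* For a fixed vector rho the function phi(t) = <mu^0(t), Ad_{g(t)h} rho> is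
   constant on each open interval, since d/dt Ad_{g(t)h} rho =
   ad_{xi^0(t)} Ad_{g(t)h} rho while mu^0 satisfies the coadjoint equation (I1).
   If rho lies in the isotropy algebra of q and hq = Q_0, then Ad_{g(t)h} rho lies
   in that of q(t) = g(t)Q_0, so its infinitesimal generator vanishes at q(t) and
   the momentum forces at the nodes annihilate it: phi does not jump at the nodes,
   and its value at t_l is 0.  Taking h = g(t)^-1 and q = q(t) gives the claim at
   time t. *)
Require Import Defs.
From HB Require Import structures.
From mathcomp Require Import all_boot all_order all_algebra.
From mathcomp Require Import all_classical all_reals all_analysis.
Import Order.TTheory GRing.Theory Num.Theory.
Import numFieldNormedType.Exports.
Local Open Scope classical_set_scope.
Local Open Scope ring_scope.

(** * Differential calculus in normed spaces *)

(** A first-order expansion at a point sees only the germ of the function. Chart expressions need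
    this form: [cinv] is meaningful only on the image of the chart domain, so their identities hold
    only near a point. *)
Lemma near_eq_is_diff (R : realType) (V W : normedModType R) (f h : V -> W)
    (x : V) (df : {linear V -> W}) : {near x, f =1 h} ->
  is_diff x f df -> is_diff x h df.
Proof.
move=> fh [fdiff fE]; have cdf : continuous df.
  by rewrite -fE; exact: diff_continuous.
have E : h \o shift x = cst (h x) + df +o_ 0 id.
  apply/eqaddoP => e e0; rewrite -fE.
  have /eqaddoP/(_ e e0) := diff_locally fdiff => H.
  have fh0 : \forall y \near 0, f (y + x) = h (y + x).
    by move: fh; rewrite (near_shift 0) subr0.
  apply: filterS2 fh0 H => y fhy; rewrite /=.
  rewrite ![(_ - _ : _ -> _) _]/(_ - _) /= fhy.
  by rewrite -(nbhs_singleton fh).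
apply: DiffDef; last exact: diff_unique.
by apply/diff_locallyP; rewrite (diff_unique cdf E).
Qed.

Lemma differentiable_scale (R : realType) (U V : normedModType R)
    (k : U -> R) (f : U -> V) (x : U) :
  differentiable k x -> differentiable f x ->
  differentiable (fun u => k u *: f u) x.
Proof.
have sbil : bilinear_for
    (GRing.Scale.Law.clone _ _ *:%R _) (GRing.Scale.Law.clone _ _ *:%R _)
    (@GRing.scale R V).
  split=> [u'|u] a y z /=; first by rewrite scalerDl scalerA.
  by rewrite scalerDr !scalerA mulrC.
(* Scaling is packed as a bilinear map, so that the product becomes a continuous bilinear map after
   the pair of [k] and [f]. *)
pose B : {bilinear R -> V -> V} := HB.pack (@GRing.scale R V)
  (bilinear_isBilinear.Build R R V V _ _ (@GRing.scale R V) sbil).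
move=> dk df; apply: (@differentiable_comp _ _ _ _ (fun u => (k u, f u))
  (fun p => B p.1 p.2)); first exact: differentiable_pair.
by apply: differentiable_bilin => p; exact: scale_continuous.
Qed.

Lemma differentiable_sum_fun (R : realType) (U V : normedModType R) (n : nat)
    (f : 'I_n -> U -> V) (x : U) : (forall i, differentiable (f i) x) ->
  differentiable (fun u => \sum_i f i u) x.
Proof.
move=> df; rewrite (_ : (fun _ => _) = \sum_i f i).
  exact: differentiable_sum.
by apply/funext => u; rewrite fct_sumE.
Qed.

Lemma derive0_constant (R : realType) (f : R -> R) (a b x y : R) :
  (forall t, a < t < b -> is_derive t 1 f 0) ->
  a < x < b -> a < y < b -> f x = f y.
Proof.
move=> df; wlog xy : x y / x <= y.
  move=> H hx hy; have [xy|/ltW yx] := leP x y; first exact: H.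
  by apply/esym; exact: H.
move=> /andP[ax xb] /andP[ay yb].
(* The mean value theorem is applied on [[x, y]], which stays inside the open interval; nothing is
   assumed at [a] and [b]. *)
have [||z _ E] := @MVT_segment R f (cst 0) x y xy.
- move=> t; rewrite in_itv/= => /andP[xt ty]; apply: df.
  by rewrite (lt_trans ax xt) (lt_trans ty yb).
- apply: derivable_within_continuous => t; rewrite in_itv/= => /andP[xt ty].
  by have [] := df t; rewrite ?(lt_le_trans ax xt)//= (le_lt_trans ty yb).
by move: E; rewrite /= mul0r => /eqP; rewrite subr_eq0 => /eqP.
Qed.

(** * One-sided limits at the ends of an interval *)

Section constant_limits.
Context {R : realType}.
Variables (f : R -> R) (a b C : R).
Hypotheses (ab : a < b) (fC : forall t, a < t < b -> f t = C).

Lemma constant_cvg_right y : f s @[s --> a^'+] --> y -> y = C.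
Proof.
move=> fy; apply: (@cvg_unique _ (@Rhausdorff R) _ _ _ _ fy).
apply: cvg_near_cst; near=> s; apply: fC.
by apply/andP; split; near: s; [exact: nbhs_right_gt|exact: nbhs_right_lt].
Unshelve. all: by end_near. Qed.

Lemma constant_cvg_left y : f s @[s --> b^'-] --> y -> y = C.
Proof.
move=> fy; apply: (@cvg_unique _ (@Rhausdorff R) _ _ _ _ fy).
apply: cvg_near_cst; near=> s; apply: fC.
by apply/andP; split; near: s; [exact: nbhs_left_gt|exact: nbhs_left_lt].
Unshelve. all: by end_near. Qed.

End constant_limits.

Section within_continuous_sides.
Context {R : realType} {T : topologicalType}.
Variables (f : R -> T) (a b v : R).
Hypothesis cf : {within `[a, b], continuous f}.

(** Points just to the left of [v] lie in [[a, b]], so the left filter refines the subspace filter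
    there. The case [v = b] is included, which covers the final time. *)
Lemma within_continuous_cvg_left : a < v <= b -> f s @[s --> v^'-] --> f v.
Proof.
move=> /andP[av vb]; have vab : `[a, b]%classic v by rewrite /= in_itv/= ltW.
have /(_ v vab) := (subspace_continuousP _ _).1 cf; apply: cvg_trans => B.
move=> fB.
have {}fB : \forall s \near v^'-, `[a, b]%classic s -> B (f s).
  exact: (@cvg_within _ (nbhs v) _ _ _ fB).
change (\forall s \near v^'-, B (f s)); near=> s.
have : `[a, b]%classic s -> B (f s) by near: s.
apply; rewrite /= in_itv/=; apply/andP; split.
  by near: s; exact: nbhs_left_ge.
by rewrite (le_trans _ vb)//; near: s; exact: nbhs_left_le.
Unshelve. all: by end_near. Qed.

Lemma within_continuous_cvg_right : a <= v < b -> f s @[s --> v^'+] --> f v.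
Proof.
move=> /andP[av vb]; have vab : `[a, b]%classic v by rewrite /= in_itv/= av ltW.
have /(_ v vab) := (subspace_continuousP _ _).1 cf; apply: cvg_trans => B.
move=> fB.
have {}fB : \forall s \near v^'+, `[a, b]%classic s -> B (f s).
  exact: (@cvg_within _ (nbhs v) _ _ _ fB).
change (\forall s \near v^'+, B (f s)); near=> s.
have : `[a, b]%classic s -> B (f s) by near: s.
apply; rewrite /= in_itv/=; apply/andP; split.
  by rewrite (le_trans av)//; near: s; exact: nbhs_right_ge.
by near: s; exact: nbhs_right_le.
Unshelve. all: by end_near. Qed.

End within_continuous_sides.

Lemma le_nodes (R : realType) (l : nat) (tn : nat -> R) (i j : nat) :
  (forall i, (i < l)%N -> tn i < tn i.+1) -> (i <= j <= l)%N -> tn i <= tn j.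
Proof.
move=> htn /andP[]; elim: j => [|j IH]; first by rewrite leqn0 => /eqP->.
rewrite leq_eqVlt => /predU1P[->//|ij jl].
by rewrite (le_trans (IH _ (ltnW jl)))// ltW// htn.
Qed.

(** * The duality pairing *)

(** [covec] records only values on the canonical basis. [ad_star] and [momentum] apply it to bare
    functions, whose linearity has to be proved separately. *)
Lemma pairing_covec_linear (R : realType) (n : nat) (f : 'rV[R]_n -> R) x :
  linear (f : _ -> R^o) -> pairing (covec f) x = f x.
Proof.
move=> lf; pose fL : {linear 'rV[R]_n -> R^o} := HB.pack (f : _ -> R^o)
  (GRing.isLinear.Build _ _ _ _ (f : _ -> R^o) lf).
exact: (pairing_covec fL).
Qed.

Section pairing_lemmas.
Context {R : realType} {n : nat}.
Implicit Types (mu : 'cV[R]_n) (x : 'rV[R]_n).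

Lemma pairingE mu x : pairing mu x = \sum_i x 0 i * mu i 0.
Proof. by rewrite /pairing mxE. Qed.

Lemma pairing_linear mu : linear (pairing mu : _ -> R^o).
Proof. by move=> a x y; rewrite /pairing mulmxDl -scalemxAl !mxE. Qed.

Lemma pairingDl mu nu x : pairing (mu + nu) x = pairing mu x + pairing nu x.
Proof. by rewrite /pairing mulmxDr mxE. Qed.

Lemma pairingBl mu nu x : pairing (mu - nu) x = pairing mu x - pairing nu x.
Proof. by rewrite /pairing mulmxBr !mxE. Qed.

Lemma pairingZl a mu x : pairing (a *: mu) x = a * pairing mu x.
Proof. by rewrite /pairing -scalemxAr mxE. Qed.

Lemma pairing0l x : pairing 0 x = 0.
Proof. by rewrite /pairing mulmx0 mxE. Qed.

Lemma pairing0r mu : pairing mu 0 = 0.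
Proof. by rewrite /pairing mul0mx mxE. Qed.

Lemma is_derive_coord (p q : nat) (A : R -> 'M[R]_(p, q)) (dA : 'M[R]_(p, q))
    (t : R) i j : is_derive t 1 A dA -> is_derive t 1 (fun s => A s i j) (dA i j).
Proof.
move=> [Ad <-]; have := Ad => /derivable_mxP/(_ i j) Aij.
by apply: DeriveDef => //; rewrite derive_mx// mxE.
Qed.

Lemma is_derive_pairing (nu : R -> 'cV[R]_n) (y : R -> 'rV[R]_n) dnu dy (t : R) :
  is_derive t 1 nu dnu -> is_derive t 1 y dy ->
  is_derive t 1 (fun s => pairing (nu s) (y s))
    (pairing dnu (y t) + pairing (nu t) dy).
Proof.
move=> hnu hy.
have -> : (fun s => pairing (nu s) (y s)) =
    \sum_i ((fun s => y s 0 i) * (fun s => nu s i 0)).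
  by apply/funext => s; rewrite pairingE fct_sumE.
rewrite !pairingE -big_split /=.
apply: is_derive_sum => i.
have := is_deriveM (is_derive_coord _ _ _ _ _ 0 i hy)
  (is_derive_coord _ _ _ _ _ i 0 hnu).
move=> /is_derive_eq; apply; rewrite /GRing.scale /=.
by congr (_ + _); rewrite mulrC.
Qed.

Lemma cvg_pairing (F : set_system R) (nu : R -> 'cV[R]_n) (y : R -> 'rV[R]_n)
    nu0 y0 : Filter F -> nu s @[s --> F] --> nu0 -> y s @[s --> F] --> y0 ->
  pairing (nu s) (y s) @[s --> F] --> pairing nu0 y0.
Proof.
move=> FF hnu hy.
have -> : (fun s => pairing (nu s) (y s)) =
    (fun s => \sum_i (y s 0 i * nu s i 0)).
  by apply/funext => s; rewrite pairingE.
rewrite pairingE; apply: cvg_big => [|i _]; first exact: add_continuous.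
apply: cvgM.
  exact: (@continuous_cvg _ _ _ _ FF _ (fun N : 'rV[R]_n => N 0 i) _
    (@matrix_normedtype.coord_continuous R 1 n 0 i y0) hy).
exact: (@continuous_cvg _ _ _ _ FF _ (fun N : 'cV[R]_n => N i 0) _
  (@matrix_normedtype.coord_continuous R n 1 i 0 nu0) hnu).
Qed.

End pairing_lemmas.

(** * Chain rules for maps and curves read in charts *)

Section chart_calculus.
Context {R : realType} {p q r : nat} {M N P : topologicalType}.

Lemma cinv_dom_near (a : chart R p M) (x : M) (D : set M) : cdom a x ->
  nbhs x D -> \forall u \near a x, D (cinv a u).
Proof.
move=> ax Dx; have := cinv_continuous ax; apply.
by rewrite coordK.
Qed.

(** The two sides differ by a factor [cinv b \o b] in the middle; it is the identity on [cdom b],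
    where continuity of [f] keeps the images of nearby points. *)
Lemma loc_comp_near (a : chart R p M) (b : chart R q N) (c : chart R r P)
    (f : M -> N) (h : N -> P) (x : M) : cdom a x -> cdom b (f x) ->
    {for x, continuous f} ->
  {near a x, (c \o h \o cinv b) \o (b \o f \o cinv a) =1
             c \o (h \o f) \o cinv a}.
Proof.
move=> ax bfx cf; have : nbhs x (f @^-1` cdom b).
  by apply: cf; apply: open_nbhs_nbhs; split => //; exact: cdom_open.
by move/(cinv_dom_near _ _ _ ax); apply: filterS => u /= ?; rewrite coordK.
Qed.

(** The image point is a separate variable [y], so that a caller can name it in simplified form,
    such as [e] for [lie_conj k e]. *)
Lemma diff_loc_comp (a : chart R p M) (b : chart R q N) (c : chart R r P)
    (f : M -> N) (h : N -> P) (x : M) (y : N) : f x = y ->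
    cdom a x -> cdom b y -> {for x, continuous f} ->
    differentiable (b \o f \o cinv a) (a x) ->
    differentiable (c \o h \o cinv b) (b y) ->
  is_diff (a x) (c \o (h \o f) \o cinv a)
    ('d (c \o h \o cinv b) (b y) \o 'd (b \o f \o cinv a) (a x)).
Proof.
move=> <- ax bfx cf df dh.
apply: near_eq_is_diff (loc_comp_near _ _ c _ h _ ax bfx cf) _.
have E : (b \o f \o cinv a) (a x) = b (f x) by rewrite /= coordK.
by rewrite -E in dh *; apply: is_diff_comp; exact: differentiableP.
Qed.

Lemma diff_loc_curve (b : chart R q N) (c : chart R r P)
    (f : R -> N) (h : N -> P) (t : R) (y : N) : f t = y -> cdom b y ->
    {for t, continuous f} ->
    differentiable (b \o f) t ->
    differentiable (c \o h \o cinv b) (b y) ->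
  is_diff t (c \o (h \o f))
    ('d (c \o h \o cinv b) (b y) \o 'd (b \o f) t).
Proof.
move=> <- bft cf df dh.
have : nbhs t (f @^-1` cdom b).
  by apply: cf; apply: open_nbhs_nbhs; split => //; exact: cdom_open.
move=> bn; apply: (@near_eq_is_diff _ _ _ ((c \o h \o cinv b) \o (b \o f))).
  by apply: filterS bn => u /= ?; rewrite coordK.
by apply: is_diff_comp; exact: differentiableP.
Qed.

End chart_calculus.

(** * Smooth maps of two variables *)

Section smooth_map2_partial.
Context {R : realType} {p q r : nat}.
Context {M : manifold R p} {N : manifold R q} {P : manifold R r}.
Variables (f : M -> N -> P) (fsm : smooth_map2 f).
Variables (a : chart R p M) (b : chart R q N) (c : chart R r P).
Hypotheses (Aa : atlas a) (Ab : atlas b) (Ac : atlas c).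
Variables (x : M) (y : N).
Hypotheses (ax : cdom a x) (yb : cdom b y) (cxy : cdom c (f x y)).

Let F (v : 'rV[R]_p * 'rV[R]_q) := c (f (cinv a v.1) (cinv b v.2)).

Lemma smooth_map2_differentiable : differentiable F (a x, b y).
Proof.
by have [_ /(_ _ _ _ Aa Ab Ac)/(_ 1%N)[+ _]] := fsm; apply; exists (x, y).
Qed.

(** [Ad] already contains first derivatives of the multiplication, so differentiating it in the
    group element takes a second derivative. *)
Lemma smooth_map2_differentiable2 v :
  differentiable (fun z => 'D_v F z) (a x, b y).
Proof.
have [_ /(_ _ _ _ Aa Ab Ac)/(_ 2%N)[_ /(_ v)[+ _]]] := fsm.
by apply; exists (x, y).
Qed.

(** Fixing [y] restricts [F] to the affine slice [u |-> (u, b y)], whose differential is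
    [w |-> (w, 0)]. *)
Lemma smooth_map2_diffl :
  is_diff (a x) (c \o (f^~ y) \o cinv a) (fun w => 'd F (a x, b y) (w, 0)).
Proof.
have -> : c \o (f^~ y) \o cinv a = F \o (fun u => (u, b y)).
  by apply/funext => u; rewrite /F /= coordK.
have dF := differentiableP smooth_map2_differentiable.
exact: (@is_diff_comp _ _ _ _ _ (fun w => (w, 0))).
Qed.

Lemma smooth_map2_diffr :
  is_diff (b y) (c \o f x \o cinv b) (fun w => 'd F (a x, b y) (0, w)).
Proof.
have -> : c \o f x \o cinv b = F \o (fun u => (a x, u)).
  by apply/funext => u; rewrite /F /= coordK.
have dF := differentiableP smooth_map2_differentiable.
exact: (@is_diff_comp _ _ _ _ _ (fun w => (0, w))).
Qed.

End smooth_map2_partial.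

Section smooth_map2_continuous.
Context {R : realType} {p q r : nat}.
Context {M : manifold R p} {N : manifold R q} {P : manifold R r}.
Variables (f : M -> N -> P) (fsm : smooth_map2 f).

Lemma smooth_map2_continuousl y : continuous (f^~ y).
Proof.
move=> x; have [cf _] := fsm.
apply: (@continuous_comp _ _ _ (fun x => (x, y)) (fun z => f z.1 z.2)).
  by apply: cvg_pair => //; exact: cvg_cst.
exact: (cf (x, y)).
Qed.

Lemma smooth_map2_continuousr x : continuous (f x).
Proof.
move=> y; have [cf _] := fsm.
apply: (@continuous_comp _ _ _ (fun y => (x, y)) (fun z => f z.1 z.2)).
  by apply: cvg_pair => //; exact: cvg_cst.
exact: (cf (x, y)).
Qed.

End smooth_map2_continuous.

(** * The adjoint representation *)

Section lie_group.
Context {R : realType} {n : nat} {G : lieGroup R n}.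
Implicit Types h k : G.
Local Notation "''R_' k" := (fun h => lie_mul h k) (at level 8, k at level 2).
Local Notation "h * k" := (lie_mul h k).
Local Notation "h ^-1" := (lie_inv h).
Local Notation e := (lie_one G).

Lemma lie_mulKV h k : h^-1 * (h * k) = k.
Proof. by rewrite lie_mulA lie_mulV lie_mul1. Qed.

(** The axioms give the left unit and left inverse; the right laws follow from this cancellation. *)
Lemma lie_mulI h k k' : h * k = h * k' -> k = k'.
Proof. by move/(congr1 (lie_mul h^-1)); rewrite !lie_mulKV. Qed.

Lemma lie_mulr1 h : h * e = h.
Proof. by apply: (@lie_mulI h^-1); rewrite lie_mulKV lie_mulV. Qed.

Lemma lie_mulrV h : h * h^-1 = e.
Proof. by apply: (@lie_mulI h^-1); rewrite lie_mulKV lie_mulr1. Qed.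

Lemma lie_invM h k : (h * k)^-1 = k^-1 * h^-1.
Proof.
apply: (@lie_mulI (h * k)); rewrite lie_mulrV -lie_mulA (lie_mulA k).
by rewrite lie_mulrV lie_mul1 lie_mulrV.
Qed.

Lemma lie_inv1 : e^-1 = e.
Proof. by rewrite -[LHS]lie_mul1 lie_mulrV. Qed.

Local Notation c1 := (chart_at e).

Definition lie_conj k h := k * h * k^-1.

Lemma lie_conj1 k : lie_conj k e = e.
Proof. by rewrite /lie_conj lie_mulr1 lie_mulrV. Qed.

Lemma lie_conjM h k : lie_conj (h * k) = lie_conj h \o lie_conj k.
Proof. by apply/funext => x; rewrite /lie_conj /= lie_invM !lie_mulA. Qed.

Lemma lie_conj_continuous k : continuous (lie_conj k).
Proof.
move=> x; have -> : lie_conj k = ('R_(k^-1)) \o lie_mul k by [].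
apply: continuous_comp.
  exact/smooth_map2_continuousr/lie_mul_smooth.
exact/smooth_map2_continuousl/lie_mul_smooth.
Qed.

Lemma chart1_dom : cdom c1 e. Proof. exact: chart_at_dom. Qed.

(* The factorisation of [Ad] may go through any chart at k^-1. *)
Lemma is_diff_conj k (b : chart R n G) : atlas b -> cdom b k^-1 ->
  is_diff (c1 e) (c1 \o lie_conj k \o cinv c1)
    ('d (c1 \o lie_mul k \o cinv b) (b k^-1) \o
     'd (b \o 'R_(k^-1) \o cinv c1) (c1 e)).
Proof.
move=> Ab bk.
have -> : lie_conj k = lie_mul k \o 'R_(k^-1).
  by apply/funext => h; rewrite /lie_conj /= lie_mulA.
apply: diff_loc_comp => //.
- exact: lie_mul1.
- exact: chart1_dom.
- exact/smooth_map2_continuousl/lie_mul_smooth.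
- have bk1 : cdom b (e * k^-1) by rewrite lie_mul1.
  by have [] := smooth_map2_diffl _ (lie_mul_smooth G) _ _ _ (chart_at_atlas e)
    Ab Ab _ _ chart1_dom bk bk1.
- have ck : cdom c1 (k * k^-1) by rewrite lie_mulrV; exact: chart1_dom.
  by have [] := smooth_map2_diffr _ (lie_mul_smooth G) _ _ _ (chart_at_atlas k)
    Ab (chart_at_atlas e) _ _ (chart_at_dom k) bk ck.
Qed.

(** By the chain rule the two translations combine into the differential of conjugation at [e], in a
    single chart. Linearity and multiplicativity of [Ad] are read off from this form. *)
Lemma AdE k : Ad k = 'd (c1 \o lie_conj k \o cinv c1) (c1 e) :> (_ -> _).
Proof.
have [_ ->] := is_diff_conj k _ (chart_at_atlas k^-1) (chart_at_dom k^-1).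
(* The charts in [Ad] are chosen at [e * k^-1] and [k * k^-1]; rewriting these points gives the
   charts at [k^-1] and [e]. *)
by apply/funext => x; rewrite /Ad /tangent_map lie_mul1 lie_mulrV.
Qed.

Lemma conj_differentiable k :
  differentiable (c1 \o lie_conj k \o cinv c1) (c1 e).
Proof. by have [] := is_diff_conj k _ (chart_at_atlas k^-1) (chart_at_dom k^-1). Qed.

Lemma AdM h k x : Ad (h * k) x = Ad h (Ad k x).
Proof.
rewrite !AdE lie_conjM.
have [_ E] := diff_loc_comp c1 c1 c1 _ _ _ _ (lie_conj1 k) chart1_dom chart1_dom
  (@lie_conj_continuous k e) (conj_differentiable k) (conj_differentiable h).
exact: (congr1 (fun F => F x) E).
Qed.

Lemma Ad1 x : Ad e x = x.
Proof.
rewrite AdE.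
have fid : {near c1 e, id =1 c1 \o lie_conj e \o cinv c1}.
  have : nbhs (c1 e) (c1 @` cdom c1).
    apply: open_nbhs_nbhs; split; first exact: cimg_open.
    by exists e => //; exact: chart1_dom.
  apply: filterS => u [h ch <-]; rewrite /= /lie_conj coordK//.
  by rewrite lie_mul1 lie_inv1 lie_mulr1.
have [_ E] := @near_eq_is_diff _ _ _ id _ _ idfun fid (is_diff_id _).
exact: (congr1 (fun F => F x) E).
Qed.

Definition mul_chart (v : 'rV[R]_n * 'rV[R]_n) := c1 (cinv c1 v.1 * cinv c1 v.2).
Definition inv_chart := c1 \o @lie_inv _ _ G \o cinv c1.

(* [Ad] in the chart at 1: the right translation by h^-1 followed by the left
   translation by h, the latter expanded along the canonical basis so that only
   partial derivatives of the multiplication with fixed directions occur. *)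
Definition Ad_coord z u : 'rV[R]_n :=
  \sum_i ('D_(z, 0) mul_chart (c1 e, inv_chart u)) 0 i *:
    'D_(0, delta_mx 0 i) mul_chart (u, inv_chart u).

(** The definition of [Ad] uses a chart chosen at [h^-1], which may jump as [h] varies. For [h] and
    [h^-1] both in the domain of [c1], that one chart serves throughout, and the dependence on [h]
    becomes explicit. *)
Lemma Ad_chart h z : cdom c1 h -> cdom c1 h^-1 -> Ad h z = Ad_coord z (c1 h).
Proof.
move=> ch chV.
have Ih : inv_chart (c1 h) = c1 h^-1 by rewrite /inv_chart /= coordK.
have A1 := chart_at_atlas e.
have [_ E] := is_diff_conj h _ A1 chV.
have c1h : cdom c1 (e * h^-1) by rewrite lie_mul1.
have hh : cdom c1 (h * h^-1) by rewrite lie_mulrV; exact: chart1_dom.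
have [_ E1] := smooth_map2_diffl _ (lie_mul_smooth G) _ _ _ A1 A1 A1 _ _
  chart1_dom chV c1h.
have [_ E2] := smooth_map2_diffr _ (lie_mul_smooth G) _ _ _ A1 A1 A1 _ _
  ch chV hh.
have dF1 := smooth_map2_differentiable _ (lie_mul_smooth G) _ _ _ A1 A1 A1 _ _
  chart1_dom chV c1h.
have dF2 := smooth_map2_differentiable _ (lie_mul_smooth G) _ _ _ A1 A1 A1 _ _
  ch chV hh.
rewrite AdE; transitivity (('d (c1 \o lie_mul h \o cinv c1) (c1 h^-1) \o
     'd (c1 \o 'R_(h^-1) \o cinv c1) (c1 e)) z).
  exact: (congr1 (fun F => F z) E).
have Ez : 'd (c1 \o 'R_(h^-1) \o cinv c1) (c1 e) z =
    'D_(z, 0) mul_chart (c1 e, inv_chart (c1 h)).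
  by rewrite Ih [RHS]deriveE//; exact: (congr1 (fun F => F z) E1).
transitivity ('d (c1 \o lie_mul h \o cinv c1) (c1 h^-1)
    ('D_(z, 0) mul_chart (c1 e, inv_chart (c1 h)))).
  exact: (congr1 _ Ez).
set w := 'D_(z, 0) _ _; rewrite [in LHS](row_sum_delta w) linear_sum.
rewrite /Ad_coord -/w; apply: eq_bigr => i _; rewrite linearZ; congr (_ *: _).
by rewrite Ih [RHS]deriveE//; exact: (congr1 (fun F => F (delta_mx 0 i)) E2).
Qed.

Lemma lie_inv_continuous : continuous (@lie_inv _ _ G).
Proof. by have [] := lie_inv_smooth G. Qed.

Lemma inv_chart_differentiable : differentiable inv_chart (c1 e).
Proof.
have A1 := chart_at_atlas e.
have [_ /(_ _ _ A1 A1)/(_ 1%N)[+ _]] := lie_inv_smooth G.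
apply; exists e => //; split; first exact: chart1_dom.
by rewrite /= lie_inv1; exact: chart1_dom.
Qed.

Lemma inv_chart1 : inv_chart (c1 e) = c1 e.
Proof. by rewrite /inv_chart /= coordK ?lie_inv1//; exact: chart1_dom. Qed.

Lemma Ad_coord_differentiable z : differentiable (Ad_coord z) (c1 e).
Proof.
have A1 := chart_at_atlas e.
have c11 : cdom c1 (e * e) by rewrite lie_mul1; exact: chart1_dom.
have dF2 := smooth_map2_differentiable2 _ (lie_mul_smooth G) _ _ _ A1 A1 A1 _ _
  chart1_dom chart1_dom c11.
apply: differentiable_sum_fun => i; apply: differentiable_scale.
  apply: (@differentiable_comp _ _ _ _
    (fun u => 'D_(z, 0) mul_chart (c1 e, inv_chart u))
    (fun N : 'rV_n => N 0 i)); last exact: differentiable_coord.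
  apply: (@differentiable_comp _ _ _ _ (fun u => (c1 e, inv_chart u))
    (fun v => 'D_(z, 0) mul_chart v)); last by rewrite inv_chart1; exact: dF2.
  by apply: differentiable_pair => //; exact: inv_chart_differentiable.
apply: (@differentiable_comp _ _ _ _ (fun u => (u, inv_chart u))
    (fun v => 'D_(0, delta_mx 0 i) mul_chart v)).
  by apply: differentiable_pair => //; exact: inv_chart_differentiable.
by rewrite inv_chart1; exact: dF2.
Qed.

(** Differentiability at [e] is enough: other base points are reached through
    [Ad (h * k) = Ad h \o Ad k]. *)
Lemma Ad_differentiable z : exists2 Phi : 'rV[R]_n -> 'rV[R]_n,
  differentiable Phi (c1 e) & \forall h \near e, Ad h z = Phi (c1 h).
Proof.
exists (Ad_coord z); first exact: Ad_coord_differentiable.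
have c1n : nbhs e (cdom c1).
  by apply: open_nbhs_nbhs; split; [exact: cdom_open|exact: chart1_dom].
have c1Vn : nbhs e (@lie_inv _ _ G @^-1` cdom c1).
  by apply: (lie_inv_continuous e); rewrite lie_inv1.
by apply: filterS2 c1n c1Vn => h; exact: Ad_chart.
Qed.

End lie_group.

(** * The exponential map and derivatives of the adjoint action *)

Section exponential.
Context {R : realType} {n : nat} {G : lieGroup R n}.
Variables (expG : 'rV[R]_n -> G) (hexp : is_exp expG).
Implicit Types h k : G.
Local Notation "''R_' k" := (fun h => lie_mul h k) (at level 8, k at level 2).
Local Notation "h * k" := (lie_mul h k).
Local Notation "h ^-1" := (lie_inv h).
Local Notation e := (lie_one G).
Local Notation c1 := (chart_at e).

Lemma Ad_linear k : linear (Ad k : 'rV[R]_n -> 'rV[R]_n).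
Proof. by move=> a x y; rewrite AdE linearP. Qed.

Lemma Ad_cvg (F : set_system R) (c : R -> G) h z : Filter F ->
  c s @[s --> F] --> h -> Ad (c s) z @[s --> F] --> Ad h z.
Proof.
move=> FF ch; have [Phi dPhi PhiE] := Ad_differentiable (G := G) (Ad h z).
(* Right translation by [h^-1] moves the limit point to [e], where [Phi] is available. *)
have E s : Ad (c s) z = Ad (c s * h^-1) (Ad h z).
  by rewrite -AdM -lie_mulA lie_mulV lie_mulr1.
under eq_fun do rewrite E.
have chV : c s * h^-1 @[s --> F] --> e.
  rewrite -(lie_mulrV h).
  exact: (cvg_comp _ _ ch
    (smooth_map2_continuousl _ (lie_mul_smooth G) h^-1 h)).
have : Phi (c1 (c s * h^-1)) @[s --> F] --> Phi (c1 e).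
  apply: (@continuous_cvg _ _ _ F FF (fun s => c1 (c s * h^-1)) Phi (c1 e)).
    exact: differentiable_continuous.
  apply: (@continuous_cvg _ _ _ F FF (fun s => c s * h^-1) c1 e) => //.
  exact: (Defs.coord_continuous chart1_dom).
rewrite -(nbhs_singleton PhiE) Ad1.
apply: cvg_trans; apply: near_eq_cvg.
have {}PhiE : \forall s \near F, Ad (c s * h^-1) (Ad h z) = Phi (c1 (c s * h^-1))
  := chV _ PhiE.
by apply: filterS PhiE => s /= ->.
Qed.

Lemma exp0 : expG 0 = e.
Proof.
have [_ /(_ 0 0) + _] := hexp 0; rewrite addr0 !scale0r => E.
by apply: (@lie_mulI _ _ _ (expG 0)); rewrite lie_mulr1 -E.
Qed.

Lemma exp_continuous x : {for 0, continuous (fun t : R => expG (t *: x))}.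
Proof. by have [/(_ 0%N)[+ _] _ _] := hexp x; apply. Qed.

Lemma exp_differentiable x :
  differentiable (c1 \o (fun t : R => expG (t *: x))) 0.
Proof.
have [/(_ 1%N)[_ /(_ _ (chart_at_atlas e))[+ _]] _ _] := hexp x; apply.
by split => //=; rewrite scale0r exp0; exact: chart1_dom.
Qed.

Lemma exp_velocity x : derive1 (c1 \o (fun t : R => expG (t *: x))) 0 = x.
Proof. by have [_ _] := hexp x; rewrite /velocity scale0r exp0. Qed.

(* The derivative depends on the curve through its velocity only, so it can be
   computed on the exponential curve that defines [ad]. *)
Lemma Ad_curve z : exists L : 'rV[R]_n -> 'rV[R]_n,
  forall (c : R -> G) (t : R), c t = e -> {for t, continuous c} ->
  differentiable (c1 \o c) t ->
  is_derive t 1 (fun s => Ad (c s) z) (L (derive1 (c1 \o c) t)).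
Proof.
have [Phi dPhi PhiE] := Ad_differentiable (G := G) z.
exists ('d Phi (c1 e)) => c t ct cc dc.
apply: (@near_eq_is_derive _ _ _ (Phi \o (c1 \o c))).
  have {}PhiE : nbhs (c t) [set h | Ad h z = Phi (c1 h)] by rewrite ct.
  have {}PhiE : \forall s \near t, Ad (c s) z = Phi (c1 (c s)) := cc _ PhiE.
  by apply: filterS PhiE => s /= ->.
have dP : differentiable Phi ((c1 \o c) t) by rewrite /= ct.
have dPc := differentiable_comp dc dP.
apply: DeriveDef; first exact: diff_derivable.
rewrite deriveE// diff_comp//= ct derive1E'//.
Qed.

Lemma ad_curve z (c : R -> G) (t : R) : c t = e -> {for t, continuous c} ->
  differentiable (c1 \o c) t ->
  is_derive t 1 (fun s => Ad (c s) z) (ad expG (derive1 (c1 \o c) t) z).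
Proof.
move=> ct cc dc; have [L HL] := Ad_curve z.
(* The same [L] serves the exponential curve with this velocity, where the derivative is [ad] by
   definition. *)
have -> : ad expG (derive1 (c1 \o c) t) z = L (derive1 (c1 \o c) t).
  set x := derive1 _ _.
  have exp00 : expG ((0 : R) *: x) = e by rewrite scale0r exp0.
  have [_] := HL _ 0 exp00 (exp_continuous x) (exp_differentiable x).
  by rewrite exp_velocity /ad derive1E.
exact: HL.
Qed.

Lemma ad_is_derive x z :
  is_derive (0 : R) 1 (fun s => Ad (expG (s *: x)) z) (ad expG x z).
Proof.
have exp00 : expG ((0 : R) *: x) = e by rewrite scale0r exp0.
have := ad_curve z _ _ exp00 (exp_continuous x) (exp_differentiable x).
by rewrite exp_velocity.
Qed.

Lemma ad_linear x : linear (ad expG x : 'rV[R]_n -> 'rV[R]_n).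
Proof.
move=> a y z.
have [_ <-] := ad_is_derive x (a *: y + z).
have -> : (fun s => Ad (expG (s *: x)) (a *: y + z)) =
    a *: (fun s => Ad (expG (s *: x)) y) + (fun s => Ad (expG (s *: x)) z).
  by apply/funext => s; rewrite Ad_linear.
have hy := ad_is_derive x y; have hz := ad_is_derive x z.
by rewrite derive_val.
Qed.

Lemma pairing_ad_star x nu y :
  pairing (ad_star expG x nu) y = pairing nu (ad expG x y).
Proof.
apply: (pairing_covec_linear _ _ (fun y => pairing nu (ad expG x y))).
by move=> a u v; rewrite ad_linear (pairing_linear nu).
Qed.

(** Writing [g s = (g s * (g t)^-1) * g t] reduces the derivative at [t] to that of a curve [c]
    through [e], applied to the fixed vector [Ad (g t * k) z]. The velocity of [c] at [t] is the
    right-trivialised velocity that occurs in (I2). *)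
Lemma Ad_curve_is_derive (g : R -> G) (t : R) k z : {for t, continuous g} ->
  differentiable (chart_at (g t) \o g) t ->
  is_derive t 1 (fun s => Ad (g s * k) z)
    (ad expG (tangent_map 'R_((g t)^-1) (g t) (velocity g t)) (Ad (g t * k) z)).
Proof.
move=> cg dg; pose c := 'R_((g t)^-1) \o g.
have -> : (fun s => Ad (g s * k) z) = (fun s => Ad (c s) (Ad (g t * k) z)).
  by apply/funext => s; rewrite -AdM /c /= -lie_mulA lie_mulKV.
have ct : c t = e by rewrite /c /= lie_mulrV.
have cdR : differentiable (c1 \o 'R_((g t)^-1) \o cinv (chart_at (g t)))
    (chart_at (g t) (g t)).
  have d1 : cdom c1 (g t * (g t)^-1) by rewrite lie_mulrV; exact: chart1_dom.
  by have [] := smooth_map2_diffl _ (lie_mul_smooth G) _ _ _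
    (chart_at_atlas (g t)) (chart_at_atlas (g t)^-1) (chart_at_atlas e) _ _
    (chart_at_dom _) (chart_at_dom _) d1.
have [dc dcE] := diff_loc_curve _ c1 _ _ _ _ erefl (chart_at_dom (g t)) cg dg cdR.
have cc : {for t, continuous c}.
  apply: continuous_comp => //.
  exact/smooth_map2_continuousl/lie_mul_smooth.
have -> : tangent_map 'R_((g t)^-1) (g t) (velocity g t) = derive1 (c1 \o c) t.
  rewrite [RHS]derive1E'//; transitivity
   (('d (c1 \o 'R_((g t)^-1) \o cinv (chart_at (g t))) (chart_at (g t) (g t)) \o
     'd (chart_at (g t) \o g) t) 1).
    rewrite /tangent_map /velocity lie_mulrV [X in 'd _ _ X]derive1E' //.
  exact/esym/(congr1 (fun F => F 1) dcE).
exact: ad_curve.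
Qed.

End exponential.

(** * Infinitesimal generators and the momentum map *)

Section action.
Context {R : realType} {n m : nat} {G : lieGroup R n} {Q : manifold R m}.
Variables (expG : 'rV[R]_n -> G) (hexp : is_exp expG).
Variables (act : G -> Q -> Q) (hact : smooth_action act).
Implicit Types h k : G.
Local Notation "h * k" := (lie_mul h k).
Local Notation "h ^-1" := (lie_inv h).
Local Notation e := (lie_one G).
Local Notation c1 := (chart_at e).

Let orbit_coord (q : Q) := chart_at q \o act^~ q \o cinv c1.

Lemma orbit_differentiable q : differentiable (orbit_coord q) (c1 e).
Proof.
have dq : cdom (chart_at q) (act e q) by rewrite (act1 hact); exact: chart_at_dom.
by have [] := smooth_map2_diffl _ (act_smooth hact) _ _ _
  (chart_at_atlas e) (chart_at_atlas q) (chart_at_atlas q) _ _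
  (chart_at_dom _) (chart_at_dom _) dq.
Qed.

(** The orbit velocity depends on [c] only through its velocity at [e], so an infinitesimal
    generator may be computed along any curve with the right velocity. *)
Lemma orbit_curve q (c : R -> G) : c 0 = e -> {for 0, continuous c} ->
  differentiable (c1 \o c) 0 ->
  derive1 (chart_at q \o (act^~ q \o c)) 0 =
    'd (orbit_coord q) (c1 e) (derive1 (c1 \o c) 0).
Proof.
move=> c0 cc dc.
have [D E] := diff_loc_curve _ (chart_at q) _ _ _ _ c0 chart1_dom cc dc
  (orbit_differentiable q).
rewrite derive1E'// derive1E'//; exact: (congr1 (fun F => F 1) E).
Qed.

Lemma inf_genE x q : inf_gen expG act x q = 'd (orbit_coord q) (c1 e) x.
Proof.
have exp00 : expG ((0 : R) *: x) = e by rewrite scale0r (exp0 expG hexp).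
rewrite /inf_gen /velocity exp00 (act1 hact).
rewrite (orbit_curve _ _ exp00 (exp_continuous _ hexp x)
  (exp_differentiable _ hexp x)).
by rewrite (exp_velocity _ hexp).
Qed.

Lemma pairing_momentum q alpha x :
  pairing (momentum expG act q alpha) x = pairing alpha (inf_gen expG act x q).
Proof.
apply: (pairing_covec_linear _ _ (fun x => pairing alpha (inf_gen expG act x q))).
by move=> a u v; rewrite !inf_genE linearP (pairing_linear alpha).
Qed.

(** The curve [k exp(s rho) k^-1] has velocity [Ad k rho] at 0 and fixes [act k q], so its orbit
    curve there is constant. The exponential of [Ad k rho] is thereby avoided. *)
Lemma inf_gen_Ad_isotropy k q rho :
  lie_subalg expG (isotropy act q) rho ->
  inf_gen expG act (Ad k rho) (act k q) = 0.
Proof.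
move=> hrho; set q' := act k q.
pose ex (s : R) := expG (s *: rho).
have ex0 : ex 0 = e by rewrite /ex scale0r (exp0 expG hexp).
pose c := lie_conj k \o ex.
have c0 : c 0 = e by rewrite /c /= ex0 lie_conj1.
have [dc E] := diff_loc_curve _ c1 _ _ _ _ ex0 chart1_dom
  (exp_continuous _ hexp rho) (exp_differentiable _ hexp rho)
  (conj_differentiable k).
have cc : {for 0, continuous c}.
  apply: continuous_comp; first exact: (exp_continuous _ hexp rho).
  exact: lie_conj_continuous.
have vc : derive1 (c1 \o c) 0 = Ad k rho.
  rewrite AdE -[in RHS](exp_velocity _ hexp rho) derive1E'//.
  rewrite derive1E'; last exact: (exp_differentiable _ hexp rho).
  exact: (congr1 (fun F => F 1) E).
rewrite inf_genE -vc -(orbit_curve _ _ c0 cc dc).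
rewrite (_ : _ \o _ = cst (chart_at q' q')); first exact: derive1_cst.
apply/funext => s; rewrite /= /c /q' /= /lie_conj !(actM hact).
rewrite -(actM hact k^-1) lie_mulV (act1 hact).
by rewrite [act (ex s) q](hrho s).
Qed.

End action.

(** * Propagation of the vanishing pairing backwards from the final time *)

Lemma pairing_transported_isotropy (R : realType) (n m : nat)
  (G : lieGroup R n) (Q : manifold R m)
  (expG : 'rV[R]_n -> G) (hexp : is_exp expG)
  (act : G -> Q -> Q) (hact : smooth_action act)
  (d : Q -> Q -> R) (l : nat) (hl : (0 < l)%N)
  (tn : nat -> R) (ht0 : tn 0%N = 0)
  (htn : forall i : nat, (i < l)%N -> tn i < tn i.+1)
  (Q0 : Q) (Qn : nat -> Q) (sigma : R) (k : nat) (hk : (0 < k)%N)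
  (ell : 'M[R]_(k, n) -> R) (xi0 : 'I_k -> 'rV[R]_n)
  (g : R -> G) (xi : 'I_k -> R -> 'rV[R]_n) (mu : 'I_k -> R -> 'cV[R]_n)
  (hsol : EL_solution expG act d Q0 hk ell sigma l tn Qn g xi mu xi0)
  (h : G) (q : Q) (rho : 'rV[R]_n) (r0 := Ordinal hk)
  (transported := fun t => Ad (lie_mul (g t) h) rho) :
  act h q = Q0 -> lie_subalg expG (isotropy act q) rho ->
  [/\ forall (s : nat) (t : R), (s < l)%N -> tn s < t < tn s.+1 ->
        pairing (mu r0 t) (transported t) = 0,
      pairing (mu_right mu r0 0) (transported 0) = 0 &
      pairing (mu_left mu r0 (tn l)) (transported (tn l)) = 0].
Proof.
have [reg int nod] := hsol => hq hrho.
pose phi t := pairing (mu r0 t) (transported t).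
have force0 s : pairing (node_force expG act d Q0 sigma tn Qn g s)
    (transported (tn s)) = 0.
  rewrite /node_force pairingZl (pairing_momentum _ hexp _ hact).
  (* The base point is rewritten as the translate of [q] by the same group element that transports
     [rho]. *)
  have -> : act (g (tn s)) Q0 = act (lie_mul (g (tn s)) h) q.
    by rewrite (actM hact) hq.
  by rewrite (inf_gen_Ad_isotropy _ hexp _ hact _ _ _ hrho) pairing0r mulr0.
have dphi i t : (i < l)%N -> tn i < t < tn i.+1 -> is_derive t 1 phi 0.
  move=> il it; have itI : `]tn i, tn i.+1[%classic t by rewrite /= in_itv.
  have [cg /(_ _ (chart_at_atlas (g t)))[/(_ t) dg _]] := reg_g reg il.
  have {}dg : differentiable (chart_at (g t) \o g) t.
    by apply: dg; split => //; exact: chart_at_dom.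
  have [dmu _] := reg_mu reg r0 il.
  have {}dmu : is_derive t 1 (mu r0) (derive1 (mu r0) t).
    rewrite derive1E; apply: DeriveDef => //.
    by apply: diff_derivable; exact: dmu.
  have E := int _ _ il it.
  have dA := Ad_curve_is_derive _ hexp _ _ h rho (cg t itI) dg.
  rewrite (eqI2 E) in dA.
  have := is_derive_pairing _ _ _ _ _ dmu dA.
  (* Transposing [ad] collects both terms of the product rule into the left side of (I1). *)
  rewrite -(pairing_ad_star _ hexp) -pairingDl (eqI1 E) pairing0l.
  exact.
have cphi i x y : (i < l)%N -> tn i < x < tn i.+1 -> tn i < y < tn i.+1 ->
    phi x = phi y.
  by move=> il; apply: derive0_constant => t; exact: dphi.
have tn_ge0 i : (i <= l)%N -> 0 <= tn i.
  by move=> il; rewrite -ht0 (le_nodes _ _ _ _ _ htn)// il.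
(* The limit of [mu] exists by regularity, and continuity of [g] up to the node makes the
   transported vector converge to its value there. *)
have phi_left i t : (i < l)%N -> tn i < t < tn i.+1 ->
    pairing (mu_left mu r0 (tn i.+1)) (transported (tn i.+1)) = phi t.
  move=> il it; apply: (constant_cvg_left phi _ _ (phi t) (htn _ il)).
    by move=> s si; exact: cphi il si it.
  apply: cvg_pairing; first exact: (reg_mu_left reg).
  apply: Ad_cvg; apply: (@continuous_cvg _ _ _ _ _ g (fun x => lie_mul x h)).
    exact/smooth_map2_continuousl/lie_mul_smooth.
  apply: (within_continuous_cvg_left _ _ _ _ (cont_g reg)).
  rewrite (le_nodes _ _ _ _ _ htn) ?il ?leqnn// andbT.
  by rewrite (le_lt_trans _ (htn _ il))// tn_ge0// ltnW.
have phi_right i t : (i < l)%N -> tn i < t < tn i.+1 ->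
    pairing (mu_right mu r0 (tn i)) (transported (tn i)) = phi t.
  move=> il it; apply: (constant_cvg_right phi _ _ (phi t) (htn _ il)).
    by move=> s si; exact: cphi il si it.
  apply: cvg_pairing; first exact: (reg_mu_right reg).
  apply: Ad_cvg; apply: (@continuous_cvg _ _ _ _ _ g (fun x => lie_mul x h)).
    exact/smooth_map2_continuousl/lie_mul_smooth.
  apply: (within_continuous_cvg_right _ _ _ _ (cont_g reg)).
  rewrite tn_ge0 ?(ltnW il)//=.
  by rewrite (lt_le_trans (htn _ il))// (le_nodes _ _ _ _ _ htn)// il leqnn.
(* Midpoints supply a sample time in each open interval, needed to pass a value across a node. *)
have mid i : (i < l)%N -> tn i < (tn i + tn i.+1) / 2 < tn i.+1.
  by move=> /htn ii; have [-> ->] := midf_lt ii.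
have left_l : pairing (mu_left mu r0 (tn l)) (transported (tn l)) = 0.
  have := congr1 (fun nu => pairing nu (transported (tn l))) (eqN3 nod).
  by rewrite pairingDl pairing0l force0 addr0.
(* Induction on the number [j] of intervals to the right of interval [i]: the last one is settled by
   (N3), and (N1) at node [i.+1] carries the value 0 one interval to the left. *)
have phi0 j i t : (i + j.+1)%N = l -> tn i < t < tn i.+1 -> phi t = 0.
  elim: j i t => [|j IH] i t ijl it.
    have il : (i < l)%N by rewrite -ijl addn1.
    rewrite -(phi_left _ _ il it) (_ : i.+1 = l)//.
    by rewrite -ijl addn1.
  have i1l : (i.+1 < l)%N by rewrite -ijl !addnS !ltnS leq_addr.
  have il := ltnW i1l.
  (* Since [0 < i.+1] computes to true, [i1l] itself proves that node [i.+1] is an interior one. *)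
  have := congr1 (fun nu => pairing nu (transported (tn i.+1)))
    (eqN1 nod (s := i.+1) i1l).
  rewrite pairingDl pairingBl pairing0l force0 addr0.
  rewrite (phi_left _ _ il it) (phi_right _ _ i1l (mid _ i1l)).
  by rewrite (IH i.+1 _ _ (mid _ i1l)) ?subr0 // addSnnS.
have phi0' i t : (i < l)%N -> tn i < t < tn i.+1 -> phi t = 0.
  by move=> il; apply: (phi0 (l - i.+1)%N); rewrite addnS -addSn subnKC.
split; [exact: phi0' | | exact: left_l].
have := phi_right 0%N _ hl (mid 0%N hl).
by rewrite (phi0' 0%N _ hl (mid 0%N hl)) ht0.
Qed.

Theorem corollary2p3 (R : realType) (n m : nat)
  (G : lieGroup R n) (Q : manifold R m)
  (expG : 'rV[R]_n -> G) (hexp : is_exp expG)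
  (act : G -> Q -> Q) (hact : smooth_action act)
  (d : Q -> Q -> R) (hd : is_distance d)
  (l : nat) (hl : (0 < l)%N)
  (tn : nat -> R) (ht0 : tn 0%N = 0)
  (htn : forall i : nat, (i < l)%N -> tn i < tn i.+1)
  (Q0 : Q) (Qn : nat -> Q)
  (sigma : R) (hsigma : 0 < sigma)
  (k : nat) (hk : (0 < k)%N)
  (ell : 'M[R]_(k, n) -> R) (hell : smooth_on setT ell)
  (xi0 : 'I_k -> 'rV[R]_n)
  (g : R -> G) (xi : 'I_k -> R -> 'rV[R]_n) (mu : 'I_k -> R -> 'cV[R]_n)
  (hd1 : forall s : nat, (0 < s <= l)%N ->
    dist_regular d (act (g (tn s)) Q0) (Qn s))
  (hsol : EL_solution expG act d Q0 hk ell sigma l tn Qn g xi mu xi0) :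
  [/\ forall (s : nat) (t : R), (s < l)%N -> tn s < t < tn s.+1 ->
        forall rho, lie_subalg expG (isotropy act (act (g t) Q0)) rho ->
          pairing (mu (Ordinal hk) t) rho = 0,
      forall rho, lie_subalg expG (isotropy act (act (g 0) Q0)) rho ->
        pairing (mu_right mu (Ordinal hk) 0) rho = 0 &
      forall rho, lie_subalg expG (isotropy act (act (g (tn l)) Q0)) rho ->
        pairing (mu_left mu (Ordinal hk) (tn l)) rho = 0].
Proof.
have key t rho := pairing_transported_isotropy _ _ _ _ _ _ hexp _ hact _ _ hl _
  ht0 htn _ _ _ _ _ _ _ _ _ _ hsol (lie_inv (g t)) (act (g t) Q0) rho.
have back t : act (lie_inv (g t)) (act (g t) Q0) = Q0.
  by rewrite -(actM hact) lie_mulV (act1 hact).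
have AdV t rho : Ad (lie_mul (g t) (lie_inv (g t))) rho = rho.
  by rewrite lie_mulrV Ad1.
split.
- move=> s t sl st rho hrho; have [+ _ _] := key t rho (back t) hrho.
  by move=> /(_ s t sl st); rewrite AdV.
- by move=> rho hrho; have [_ + _] := key 0 rho (back 0) hrho; rewrite AdV.
- by move=> rho hrho; have [_ _ +] := key (tn l) rho (back _) hrho; rewrite AdV.
Qed.
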